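(* For any $s\ge0$ let $Z_s$ be the generator of an $lC_0$-semigroup in a sequentially complete (Hausdorff) locally convex space $\mathbf{X}$. Suppose that for any $l_0\ge0$ the set $$\mathbf{A}_{l_0}=\{\exp(lZ_s) : l\in[0,l_0],\ s\ge0\}$$ is equicontinuous. Let $D$ be the set of all $f\in\mathcal{D}(Z_0)$ for which there exists a family $\{f_s\}_{s>0}$, $f_s\in\mathcal{D}(Z_s)$, such that $\lim_{s\to0}f_s=f$ and $\lim_{s\to0}Z_sf_s=Z_0f$. Then the following conditions are equivalent: (i) for any $t_0>0$ and $f\in\mathbf{X}$, $\exp(lZ_s)f$ converges to $\exp(lZ_0)f$ as $s\to0$ uniformly with respect to $l\in[0,t_0]$; (ii) $D$ is a core of the generator $Z_0$.
   Context: $\mathbf{X}$ is over $\mathbb{T}\in\{\mathbb{R},\mathbb{C}\}$ with topology generated by semi-norms $\|\cdot\|_\alpha$, $\alpha\in\Omega$. $\mathcal{L}(\mathbf{X})$ is the space of bounded linear operators in $\mathbf{X}$ with the topology of pointwise convergence; $I$ is the identity; $\mathcal{D}(C)$ is the domain of $C$. A family $G_\beta\in\mathcal{L}(\mathbf{X})$, $\beta\in\Gamma$, is equicontinuous if for any $\alpha\in\Omega$ there are finitely many $\alpha_1,\dots,\alpha_n\in\Omega$ and $b_1,\dots,b_n>0$ with $\sup_\beta\|G_\beta x\|_\alpha\le\sum_i b_i\|x\|_{\alpha_i}$ for all $x\in\mathbf{X}$. For $F:[0,\infty)\to\mathcal{L}(\mathbf{X})$ and $s\ge0$ put $\mathbf{B}^F_s=\{F(\tfrac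 dn)^m : md/n\le s,\ n,m\in\mathbb{N},\ d\ge0\}$. $\mathcal{E}_{\mathbf{X}}$ is the set of $F:[0,\infty)\to\mathcal{L}(\mathbf{X})$ with $F(0)=I$ and $\mathbf{B}^F_s$ equicontinuous for every $s\ge0$. An $lC_0$-semigroup is a continuous function $T:[0,\infty)\to\mathcal{L}(\mathbf{X})$ with $T(0)=I$, $T(l+m)=T(l)T(m)$ for $l,m\ge0$, and $T\in\mathcal{E}_{\mathbf{X}}$. Its generator is the operator $Z\psi=\lim_{h\to0}h^{-1}(T(h)\psi-\psi)$ with domain the set of all $\psi$ for which the limit exists; one writes $T(t)=\exp(tZ)$ (a generator determines its semigroup). A set $D\subset\mathcal{D}(Z)$ is a core of the generator $Z$ if the closure of $\{(x,Zx):x\in D\}$ in $\mathbf{X}\times\mathbf{X}$ equals the graph of $Z$. Limits $s\to0$ are taken over $s>0$. *)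

(* Defs.v *)
From HB Require Import structures.
From mathcomp Require Import all_boot all_order all_algebra.
From mathcomp Require Import complex.
From mathcomp Require Import all_classical all_reals all_analysis.

Set Implicit Arguments.
Unset Strict Implicit.
Unset Printing Implicit Defensive.

Import Order.TTheory GRing.Theory Num.Theory.
Import numFieldNormedType.Exports.

Local Open Scope classical_set_scope.
Local Open Scope complex_scope.
Local Open Scope ring_scope.

(* The scalar field is either R or C; seminorms, time and the index s are
   always in R. *)
Variant scalar_kind := RealScalars | ComplexScalars.

Definition scalars (R : realType) (k : scalar_kind) : numFieldType :=
  match k with RealScalars => R | ComplexScalars => R[i] end.

Definition of_real (R : realType) (k : scalar_kind) : R -> scalars R k :=
  match k with RealScalars => fun a => a | ComplexScalars => fun a => a%:C end.
Arguments of_real {R} k a.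

Section LocallyConvex.
Variables (R : realType) (k : scalar_kind) (X : tvsType (scalars R k)).
Variables (Omega : Type) (p : Omega -> X -> R).

Definition seminorm (q : X -> R) : Prop :=
  [/\ forall x, 0 <= q x,
      forall x y, q (x + y) <= q x + q y
    & forall (a : scalars R k) x,
        of_real k (q (a *: x)) = `|a| * of_real k (q x)].

(* Stated on entourages rather than on neighbourhoods: a [tvsType] carries a
   uniform structure that induces its topology, but is not required to be
   compatible with the addition.  Requiring it to be the translation-invariant
   uniformity of the seminorms fixes the topology together with the notions of
   Cauchy sequence and of uniform convergence. *)
Definition generated_by_seminorms : Prop :=
  (forall alpha, seminorm (p alpha)) /\
  forall E : set (X * X), entourage E <->
    exists (n : nat) (alpha : 'I_n -> Omega) (e : R), 0 < e /\
      [set xy | forall i, p (alpha i) (xy.1 - xy.2) < e] `<=` E.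

(* L(X): in a locally convex space a bound of a single operator by finitely
   many seminorms is the same as its continuity. *)
Definition bounded_linear : set (X -> X) := [set G | linear G /\ continuous G].

Definition seminorm_equicontinuous (B : set (X -> X)) : Prop :=
  B `<=` bounded_linear /\
  forall alpha, exists (n : nat) (alphas : 'I_n -> Omega) (b : 'I_n -> R),
    (forall i, 0 < b i) /\
    forall G, B G -> forall x,
      p alpha (G x) <= \sum_(i < n) b i * p (alphas i) x.

(* A map defined on [0, +oo[ is a function on R whose values at negative
   arguments are irrelevant. *)
Definition powers_upto (F : R -> X -> X) (s : R) : set (X -> X) :=
  [set G | exists (n m : nat) (d : R),
    [/\ (0 < n)%N, (0 < m)%N, 0 <= d, m%:R * d / n%:R <= s
      & G = iter m (F (d / n%:R))]].

Definition class_E (F : R -> X -> X) : Prop :=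
  [/\ forall t, 0 <= t -> bounded_linear (F t),
      F 0 = idfun
    & forall s, 0 <= s -> seminorm_equicontinuous (powers_upto F s)].

Definition lC0_semigroup (T : R -> X -> X) : Prop :=
  [/\ {within `[0, +oo[, continuous (T : R -> {ptws X -> X})},
      T 0 = idfun,
      forall l m, 0 <= l -> 0 <= m -> T (l + m) = T l \o T m
    & class_E T].

(* A partially defined operator; the values of [op_val] outside [op_dom] are
   irrelevant. *)
Record operator := Operator { op_dom : set X; op_val :> X -> X }.

Definition op_graph (Z : operator) : set (X * X) :=
  [set (x, Z x) | x in op_dom Z].

Definition generator_of (T : R -> X -> X) (Z : operator) : Prop :=
  let quotient (psi : X) (h : R) : X := of_real k h^-1 *: (T h psi - psi) in
  op_dom Z = [set psi | exists l : X, quotient psi h @[h --> 0^'+] --> l] /\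
  forall psi, op_dom Z psi -> quotient psi h @[h --> 0^'+] --> Z psi.

Definition core (Z : operator) (D : set X) : Prop :=
  D `<=` op_dom Z /\ closure [set (x, Z x) | x in D] = op_graph Z.

Definition sequentially_complete : Prop :=
  forall u : nat -> X, cauchy (u n @[n --> \oo]) ->
    exists l : X, u n @[n --> \oo] --> l.

Definition limit_domain (Z : R -> operator) : set X :=
  [set f | op_dom (Z 0) f /\
    exists fs : R -> X,
      [/\ forall s, 0 < s -> op_dom (Z s) (fs s),
          fs s @[s --> 0^'+] --> f
        & Z s (fs s) @[s --> 0^'+] --> Z 0 f]].

End LocallyConvex.

(* Main.v *)
Require Import Defs.
From mathcomp Require Import all_boot all_order all_algebra.
From mathcomp Require Import complex ring lra.
From mathcomp Require Import all_classical all_reals all_analysis.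

Import Order.TTheory GRing.Theory Num.Theory.
Import numFieldNormedType.Exports.

Local Open Scope classical_set_scope.
Local Open Scope ring_scope.

(* Resolvents are avoided, as local equicontinuity does not make the Laplace
   transform of a semigroup converge; telescoping sums replace them.

   (ii) => (i).  For f in the domain of Z_0 put w_j = exp(j h Z_0) f.  The core
   property and the definition of D give, for small s, elements a_j of the
   domain of Z_s such that a_j is much closer to w_j than h and Z_s a_j is close
   to Z_0 w_j.  Hence the broken line through the a_j has a derivative close to
   its image under Z_s, and telescoping along it shows that it is close to
   exp(l Z_s) a_0, uniformly in l.  The same estimate at s = 0 compares
   exp(l Z_0) f with the broken line through the w_j.

   (i) => (ii).  The means of exp(l Z_s) f over l in [0, h], defined as limits of
   Riemann sums, lie in the domain of Z_s, which maps them to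
   (exp(h Z_s) f - f) / h.  Under (i) both converge as s -> 0, so the mean for
   s = 0 is in D; it approximates f in the graph norm as h -> 0. *)

Reserved Notation "a **: x" (at level 40).

(** * Real scalars and continuous seminorms *)

Section RealScaling.
Set Implicit Arguments.
Unset Strict Implicit.
Unset Printing Implicit Defensive.
Variables (R : realType) (k : scalar_kind).

Lemma half_lt (e : R) : 0 < e -> e / 2 < e.
Proof. by move=> e0; rewrite ltr_pdivrMr // ltr_pMr // ltr1n. Qed.

Lemma of_realD (a b : R) : of_real k (a + b) = of_real k a + of_real k b.
Proof. by case: k => //=; rewrite rmorphD. Qed.

Lemma of_realM (a b : R) : of_real k (a * b) = of_real k a * of_real k b.
Proof. by case: k => //=; rewrite rmorphM. Qed.

Lemma of_real0 : of_real k (0 : R) = 0.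
Proof. by case: k. Qed.

Lemma of_real1 : of_real k (1 : R) = 1.
Proof. by case: k. Qed.

Lemma of_realN (a : R) : of_real k (- a) = - of_real k a.
Proof. by case: k => //=; rewrite rmorphN. Qed.

Lemma of_real_inj : injective (@of_real R k).
Proof. by case: k => //= a b []. Qed.

Lemma normr_of_real (a : R) : `|of_real k a| = of_real k `|a|.
Proof.
by case: k => //=; rewrite normc_def /= expr0n /= addr0 sqrtr_sqr.
Qed.

Variable X : tvsType (scalars R k).

(** Real multiples, for either scalar field; the estimates thus treat both fields at once. *)
Definition rscale (a : R) (x : X) : X := of_real k a *: x.
Notation "a **: x" := (rscale a x).

Lemma rscaleDl a b x : (a + b) **: x = a **: x + b **: x.
Proof. by rewrite /rscale of_realD scalerDl. Qed.

Lemma rscaleDr a x y : a **: (x + y) = a **: x + a **: y.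
Proof. by rewrite /rscale scalerDr. Qed.

Lemma rscaleN a x : a **: (- x) = - (a **: x).
Proof. by rewrite /rscale scalerN. Qed.

Lemma rscaleNl a x : (- a) **: x = - (a **: x).
Proof. by rewrite /rscale of_realN scaleNr. Qed.

Lemma rscaleBr a x y : a **: (x - y) = a **: x - a **: y.
Proof. by rewrite rscaleDr rscaleN. Qed.

Lemma rscaleBl a b x : (a - b) **: x = a **: x - b **: x.
Proof. by rewrite rscaleDl rscaleNl. Qed.

Lemma rscaleA a b x : a **: (b **: x) = (a * b) **: x.
Proof. by rewrite /rscale scalerA of_realM. Qed.

Lemma rscale1 x : 1 **: x = x.
Proof. by rewrite /rscale of_real1 scale1r. Qed.

Lemma rscale0 x : 0 **: x = 0.
Proof. by rewrite /rscale of_real0 scale0r. Qed.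

Lemma rscaler0 a : a **: 0 = 0.
Proof. by rewrite /rscale scaler0. Qed.

Lemma rscale_natl n x : n%:R **: x = x *+ n.
Proof. by elim: n => [|n IH]; rewrite ?rscale0 // -natr1 rscaleDl rscale1 IH mulrSr. Qed.

Section Seminorm.
Variable q : X -> R.
Hypothesis snq : seminorm q.

Lemma sn_ge0 x : 0 <= q x. Proof. by case: snq. Qed.

Lemma snD x y : q (x + y) <= q x + q y. Proof. by case: snq. Qed.

Lemma snZ a x : q (a **: x) = `|a| * q x.
Proof.
by case: snq => _ _ h; apply: of_real_inj; rewrite h normr_of_real of_realM.
Qed.

Lemma snZ_ge0 a x : 0 <= a -> q (a **: x) = a * q x.
Proof. by move=> a0; rewrite snZ ger0_norm. Qed.

Lemma sn0 : q 0 = 0.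
Proof. by rewrite -(rscale0 0) snZ normr0 mul0r. Qed.

Lemma snN x : q (- x) = q x.
Proof. by rewrite -(rscale1 x) -rscaleNl !snZ normrN. Qed.

Lemma snC x y : q (x - y) = q (y - x).
Proof. by rewrite -snN opprB. Qed.

Lemma sn_tri y x z : q (x - z) <= q (x - y) + q (y - z).
Proof. by rewrite -[x - z](subrKA y) snD. Qed.

Lemma sn_sum (F : nat -> X) n :
  q (\sum_(0 <= i < n) F i) <= \sum_(0 <= i < n) q (F i).
Proof.
elim/big_ind2: _ => [|x1 x2 y1 y2 h1 h2|//]; first by rewrite sn0.
by apply: (le_trans (snD _ _)); apply: lerD.
Qed.

Lemma sn_sum_le (F : nat -> X) n M :
  (forall i, (i < n)%N -> q (F i) <= M) ->
  q (\sum_(0 <= i < n) F i) <= n%:R * M.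
Proof.
move=> h; apply: (le_trans (sn_sum _ _)).
rewrite mulr_natl -[n in M *+ n]subn0 -sumr_const_nat.
by apply: ler_sum_nat => i /andP[_ /h].
Qed.

End Seminorm.

(* Continuous seminorms. *)
Definition csn (q : X -> R) :=
  seminorm q /\
  forall e, 0 < e -> entourage [set xy : X * X | q (xy.1 - xy.2) < e].

Lemma csn_sn q : csn q -> seminorm q. Proof. by case. Qed.

Lemma csnZ b q : 0 <= b -> csn q -> csn (fun x => b * q x).
Proof.
move=> b0 [sq cq]; split; first split.
- by move=> x; rewrite mulr_ge0 // sn_ge0.
- by move=> x y; rewrite -mulrDr ler_wpM2l // snD.
- move=> a x; case: sq => _ _ h; rewrite !of_realM h mulrCA //.
(* [b] may vanish, hence the radius [e / (b + 1)]. *)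
move=> e e0; apply: filterS (cq (e / (b + 1)) _); last first.
  by rewrite divr_gt0 // ltr_wpDl.
move=> [x y] /=; rewrite ltr_pdivlMr ?ltr_wpDl // mulrC.
apply: le_lt_trans; rewrite ler_wpM2r ?sn_ge0 //; lra.
Qed.

Lemma csnD q1 q2 : csn q1 -> csn q2 -> csn (fun x => q1 x + q2 x).
Proof.
move=> [s1 c1] [s2 c2]; split; first split.
- by move=> x; rewrite addr_ge0 // sn_ge0.
- by move=> x y; rewrite addrACA lerD // snD.
- move=> a x; case: s1 => _ _ h1; case: s2 => _ _ h2.
  by rewrite !of_realD h1 h2 mulrDr.
move=> e e0; have e20 : 0 < e / 2 by rewrite divr_gt0.
apply: filterS (filterI (c1 _ e20) (c2 _ e20)) => -[x y] /= [h1 h2]; lra.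
Qed.

Lemma csn0 : csn (fun=> 0).
Proof.
split; first by split=> [//|_ _|a x]; rewrite ?addr0 // of_real0 mulr0.
by move=> e e0; apply: filterS filterT.
Qed.

Lemma csn_sum n (q : 'I_n -> X -> R) :
  (forall i, csn (q i)) -> csn (fun x => \sum_(i < n) q i x).
Proof.
elim: n q => [|n IH] q cq.
  by under eq_fun do rewrite big_ord0; exact: csn0.
by under eq_fun do rewrite big_ord_recl; apply: csnD => //; exact: IH.
Qed.

Lemma csn_cvg (T : Type) (F : set_system T) {FF : Filter F} (u : T -> X) x q e :
  csn q -> u @ F --> x -> 0 < e -> \forall t \near F, q (x - u t) < e.
Proof. by move=> [_ cq] /cvg_app_entourageP h /cq /h. Qed.

End RealScaling.

#[local] Notation "a **: x" := (rscale a x).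

(** * Entourages, limits, closures and equicontinuity through continuous seminorms *)

Section Generated.
Set Implicit Arguments.
Unset Strict Implicit.
Unset Printing Implicit Defensive.
Variables (R : realType) (k : scalar_kind) (X : tvsType (scalars R k)).
Variables (Omega : Type) (p : Omega -> X -> R).
Hypothesis X_gen : generated_by_seminorms p.

Lemma csn_gen alpha : csn (p alpha).
Proof.
case: X_gen => sp ep; split=> // e e0; apply/ep.
by exists 1, (fun=> alpha), e; split=> // xy /(_ ord0).
Qed.

(** The sum of finitely many seminorms dominates each of them, so one continuous seminorm replaces
    the finite family. *)
Lemma entourage_csn (E : set (X * X)) : entourage E ->
  exists2 q, csn q & exists2 e, 0 < e &
    forall x y, q (x - y) < e -> E (x, y).
Proof.
case: X_gen => sp ep /ep [n [al [e [e0 hE]]]].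
exists (fun x => \sum_(i < n) p (al i) x).
  by apply: csn_sum => i; exact: csn_gen.
exists e => // x y h; apply: hE => i /=; apply: le_lt_trans h.
by rewrite (bigD1 i) //= lerDl sumr_ge0 // => j _; rewrite sn_ge0.
Qed.

Lemma cvg_csnP (T : Type) (F : set_system T) {FF : Filter F} (u : T -> X) x :
  (forall q e, csn q -> 0 < e -> \forall t \near F, q (x - u t) < e) ->
  u @ F --> x.
Proof.
move=> h; apply/cvg_app_entourageP => E /entourage_csn[q cq [e e0 hE]].
by apply: filterS (h q e cq e0) => t /hE.
Qed.

Lemma nbhs_csn (x : X) U : nbhs x U -> exists2 q, csn q & exists2 e, 0 < e &
    forall y, q (x - y) < e -> U y.
Proof.
move=> /nbhsP[E /entourage_csn[q cq [e e0 hE]] EU].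
by exists q => //; exists e => // y /hE ?; apply: EU; apply/xsectionP.
Qed.

Lemma csn_nbhs (x : X) q e : csn q -> 0 < e -> nbhs x [set y | q (x - y) < e].
Proof. by move=> cq e0; apply: csn_cvg (@cvg_id _ _) e0. Qed.

Lemma csn_closureP (A : set (X * X)) x y :
  closure A (x, y) <->
  forall q e, csn q -> 0 < e -> exists2 z, A z & q (x - z.1) < e /\ q (y - z.2) < e.
Proof.
split=> [h q e cq e0|h B [[U V] /= [/nbhs_csn[q1 c1 [e1 e10 h1]]
    /nbhs_csn[q2 c2 [e2 e20 h2]]] UV]].
  have [] := h [set z | q (x - z.1) < e /\ q (y - z.2) < e].
    exists ([set z | q (x - z) < e], [set z | q (y - z) < e]) => //=.
    by split; exact: csn_nbhs.
  by move=> z [Az ?]; exists z.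
have [z Az [zx zy]] := h _ (Num.min e1 e2) (csnD c1 c2) (ltac:(by rewrite lt_min e10)).
exists z; split => //; apply: UV; move: zx zy.
rewrite !lt_min => /andP[zx _] /andP[_ zy].
have [s1 _] := c1; have [s2 _] := c2.
split=> /=; [apply: h1; apply: le_lt_trans zx|apply: h2; apply: le_lt_trans zy].
  by rewrite lerDl sn_ge0.
by rewrite lerDr sn_ge0.
Qed.

(** By homogeneity: a positive multiple of [x] at which the sum is below [e] satisfies [q < 1]. *)
Lemma csn_finite_bound q : csn q ->
  exists n (al : 'I_n -> Omega) (e : R), 0 < e /\
    forall x, e * q x <= \sum_(i < n) p (al i) x.
Proof.
move=> [sq cq]; have [sp ep] := X_gen.
have /ep[n [al [e [e0 hE]]]] := cq 1 ltr01.
exists n, al, e; split=> // x.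
set S := \sum_(i < n) _.
have S0 : 0 <= S by apply: sumr_ge0 => i _; rewrite sn_ge0.
(* The slack [d] permits division by [S + d] also when [S = 0]. *)
apply/ler_addgt0Pr => d d0.
have Sd : 0 < S + d by rewrite ltr_wpDl.
have ed : 0 < e / (S + d) by rewrite divr_gt0.
have := hE (e / (S + d) **: x, 0); rewrite /= subr0 (snZ_ge0 _ _ (ltW ed)) //.
rewrite mulrAC ltr_pdivrMr // mul1r => /(_ _)/ltW; apply => i.
rewrite (snZ_ge0 _ _ (ltW ed)) // mulrAC ltr_pdivrMr // ltr_pM2l //.
apply: (@le_lt_trans _ _ S); last by rewrite ltrDl.
by rewrite /S (bigD1 i) //= lerDl sumr_ge0 // => j _; rewrite sn_ge0.
Qed.

(** Domination of [q] by finitely many generating seminorms carries equicontinuity over to every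
    continuous seminorm, with a single [Q]. *)
Lemma csn_equi (B : set (X -> X)) : seminorm_equicontinuous p B ->
  forall q, csn q -> exists2 Q, csn Q & forall G, B G -> forall x, q (G x) <= Q x.
Proof.
move=> [_ eqB] q /csn_finite_bound[n [al [e [e0 qe]]]].
have /choice[Q hQ] : forall i, exists Q, csn Q /\
    forall G, B G -> forall x, p (al i) (G x) <= Q x.
  move=> i; have [m [bl [b [b0 hb]]]] := eqB (al i).
  exists (fun x => \sum_(j < m) b j * p (bl j) x); split=> //.
  by apply: csn_sum => j; apply: csnZ; [exact: ltW|exact: csn_gen].
exists (fun x => e^-1 * \sum_(i < n) Q i x).
  by apply: csnZ; [rewrite invr_ge0 ltW|apply: csn_sum => i; case: (hQ i)].
move=> G BG x; rewrite -ler_pdivrMl ?invr_gt0 // invrK.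
apply: (le_trans (qe _)); apply: ler_sum => i _.
by case: (hQ i) => _; apply.
Qed.
End Generated.

(* Cancels opposite terms of a right-nested sum until nothing is left. *)
Ltac zmod_loop :=
  lazymatch goal with
  | |- 0 = 0 => reflexivity
  | |- - ?x + ?x = 0 => exact: addNr
  | |- ?x + - ?x = 0 => exact: subrr
  | |- - ?x + (?x + _) = 0 => rewrite addKr; zmod_loop
  | |- ?x + (- ?x + _) = 0 => rewrite addNKr; zmod_loop
  | |- - ?x + ?r = 0 =>
      lazymatch r with
      | context [?a + (x + ?b)] => rewrite (addrCA a x b)
      | context [?a + x] => rewrite (addrC a x)
      end; zmod_loop
  | |- ?x + ?r = 0 =>
      lazymatch r with
      | context [?a + (- x + ?b)] => rewrite (addrCA a (- x) b)
      | context [?a + - x] => rewrite (addrC a (- x))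
      end; zmod_loop
  end.
Ltac zmod :=
  apply/eqP; rewrite -subr_eq0 ?(opprB, opprD, opprK) -?addrA; apply/eqP;
  zmod_loop.

(** * Locally equicontinuous semigroups *)

Section Semigroup.
Set Implicit Arguments.
Unset Strict Implicit.
Unset Printing Implicit Defensive.
Variables (R : realType) (k : scalar_kind) (X : tvsType (scalars R k)).

Lemma small_step (c d : R) : 0 < d ->
  exists N : nat, forall n, (N <= n)%N -> c / n.+1%:R <= d.
Proof.
move=> d0; exists (Num.bound (c / d)) => n Nn.
rewrite ler_pdivrMr // -ler_pdivrMl // mulrC.
apply: le_trans (ler_norm _) _; apply: le_trans (ltW (archi_boundP (normr_ge0 _))) _.
have -> : Num.bound `|c / d| = Num.bound (c / d) by rewrite /Num.bound normr_id.
by rewrite ler_nat; apply: leqW.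
Qed.

(** The semigroup properties on which the estimates rest, stated for all continuous seminorms
    instead of the generating family. *)
Definition lequi_semigroup (T : R -> X -> X) : Prop :=
  [/\ forall l, 0 <= l -> linear (T l), T 0 = idfun,
      forall l m, 0 <= l -> 0 <= m -> T (l + m) = T l \o T m,
      forall x q e, csn q -> 0 < e ->
        exists2 d, 0 < d & forall h, 0 <= h <= d -> q (T h x - x) <= e
    & forall q L, csn q -> exists2 Q, csn Q &
        forall l x, 0 <= l <= L -> q (T l x) <= Q x].

(* [x] is in the domain of the generator of [T] and is mapped to [y] there. *)
Definition right_deriv0 (T : R -> X -> X) (x y : X) : Prop :=
  forall q e, csn q -> 0 < e -> exists2 d, 0 < d &
    forall h, 0 < h <= d -> q (T h x - x - h **: y) <= e * h.

Section OneSemigroup.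
Variable T : R -> X -> X.
Hypothesis sgT : lequi_semigroup T.

Lemma sgB l x y : 0 <= l -> T l (x - y) = T l x - T l y.
Proof.
case: sgT => h _ _ _ _ /h lT; have := lT (- 1) y x.
by rewrite !scaleN1r [- y + x]addrC [- T l y + _]addrC.
Qed.

Lemma sg_0 l : 0 <= l -> T l 0 = 0.
Proof. by move=> l0; have := sgB 0 0 l0; rewrite !subrr. Qed.

Lemma sgN l x : 0 <= l -> T l (- x) = - T l x.
Proof. by move=> l0; rewrite -sub0r sgB // sg_0 // sub0r. Qed.

Lemma sgD l x y : 0 <= l -> T l (x + y) = T l x + T l y.
Proof. by move=> l0; have := sgB x (- y) l0; rewrite sgN // !opprK. Qed.

Lemma sgZ l a x : 0 <= l -> T l (a **: x) = a **: T l x.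
Proof.
case: sgT => h _ _ _ _ l0; have := h l l0 (of_real k a) x 0.
by rewrite /rscale sg_0 // !addr0.
Qed.

Lemma sg_sum (I : Type) (r : seq I) (F : I -> X) l : 0 <= l ->
  T l (\sum_(i <- r) F i) = \sum_(i <- r) T l (F i).
Proof.
move=> l0; elim: r => [|i r IH]; first by rewrite !big_nil sg_0.
by rewrite !big_cons sgD // IH.
Qed.

Lemma sgT0 x : T 0 x = x.
Proof. by case: sgT => _ ->. Qed.

Lemma sgTD l m x : 0 <= l -> 0 <= m -> T (l + m) x = T l (T m x).
Proof. by case: sgT => _ _ h _ _ l0 m0; rewrite h. Qed.

Lemma right_deriv0D x y x' y' : right_deriv0 T x y -> right_deriv0 T x' y' ->
  right_deriv0 T (x + x') (y + y').
Proof.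
move=> dx dx' q e cq e0; have e20 : 0 < e / 2 by rewrite divr_gt0.
have [d d0 hd] := dx q _ cq e20; have [d' d'0 hd'] := dx' q _ cq e20.
exists (Num.min d d'); first by rewrite lt_min d0.
move=> h /andP[h0]; rewrite le_min => /andP[hd1 hd2].
rewrite sgD ?(ltW h0) // rscaleDr.
have -> : T h x + T h x' - (x + x') - (h **: y + h **: y') =
  (T h x - x - h **: y) + (T h x' - x' - h **: y') by zmod.
apply: le_trans (snD (csn_sn cq) _ _) _.
rewrite [e]splitr mulrDl; apply: lerD; first by apply: hd; rewrite h0.
by apply: hd'; rewrite h0.
Qed.

Lemma right_deriv0Z x y a : right_deriv0 T x y ->
  right_deriv0 T (a **: x) (a **: y).
Proof.
move=> dx q e cq e0; have a0 : 0 < `|a| + 1 by rewrite ltr_wpDl.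
have [d d0 hd] := dx q _ cq (divr_gt0 e0 a0).
exists d => // h /[dup] /andP[h0 _] /hd.
rewrite sgZ ?(ltW h0) // rscaleA [h * a]mulrC -rscaleA -!rscaleBr (snZ (csn_sn cq)).
rewrite mulrAC ler_pdivlMr // mulrC; apply: le_trans.
by rewrite ler_wpM2r ?(sn_ge0 (csn_sn cq)) // lerDl.
Qed.

Lemma right_deriv0T l x y : 0 <= l -> right_deriv0 T x y ->
  right_deriv0 T (T l x) (T l y).
Proof.
move=> l0 dx q e cq e0; have [_ _ _ _ /(_ q l cq)[Q cQ qQ]] := sgT.
have [d d0 hd] := dx Q e cQ e0; exists d => // h /[dup] /andP[h0 _] /hd.
rewrite -sgTD ?(ltW h0) // [h + l]addrC sgTD ?(ltW h0) // -sgZ // -!sgB //.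
by apply: le_trans; apply: qQ; rewrite l0 lexx.
Qed.

(** Mean value inequality: [T h x - x] telescopes into increments over short times [t], each of them
    about [t **: T (j%:R * t) z] and hence near [t **: y]. *)
Lemma sg_increment q x z y h M : csn q -> 0 <= h ->
  right_deriv0 T x z ->
  (forall r, 0 <= r <= h -> q (T r z - y) <= M) ->
  q (T h x - x - h **: y) <= h * M.
Proof.
move=> cq h0 dx hM; have sq := csn_sn cq.
have [_ _ _ _ /(_ q h cq)[Q cQ qQ]] := sgT.
apply/ler_addgt0Pr => e e0.
have h10 : 0 < h + 1 by rewrite ltr_wpDl.
(* The short-time remainders are later moved by [T (j%:R * t)], so they are measured in [Q]. They
   add up to [h * (e / (h + 1))], at most [e] even for [h = 0]. *)
have [d d0 hd] := dx Q _ cQ (divr_gt0 e0 h10).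
have [n hn] := small_step h d0; have {}hn := hn n (leqnn n).
set t := h / n.+1%:R in hn.
have t0 : 0 <= t by rewrite divr_ge0.
have tn : n.+1%:R * t = h by rewrite mulrC divfK // pnatr_eq0.
suff H j : (j <= n.+1)%N ->
    q (T (j%:R * t) x - x - (j%:R * t) **: y) <= j%:R * t * (M + e / (h + 1)).
  have := H _ (leqnn _); rewrite tn => /le_trans; apply; rewrite mulrDr lerD2l.
  by rewrite mulrCA ler_piMr ?(ltW e0) // ler_pdivrMr // mul1r lerDl.
elim: j => [_|j IH jn]; first by rewrite mul0r sgT0 rscale0 subr0 subrr (sn0 sq) mul0r.
have jt0 : 0 <= j%:R * t by rewrite mulr_ge0.
have jth : j%:R * t <= h by rewrite -tn ler_wpM2r // ler_nat ltnW.
have -> : T (j.+1%:R * t) x - x - (j.+1%:R * t) **: y =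
   (T (j%:R * t) x - x - (j%:R * t) **: y) +
   (T (j%:R * t) (T t x - x - t **: z) + t **: (T (j%:R * t) z - y)).
  rewrite -natr1 mulrDl mul1r sgTD // !sgB // sgZ // rscaleBr rscaleDl.
  zmod.
apply: le_trans (snD sq _ _) _; rewrite -natr1 !mulrDl mul1r -mulrDl.
rewrite mulrDl.
apply: lerD; first exact: IH (ltnW jn).
apply: le_trans (snD sq _ _) _; rewrite mulrDr addrC; apply: lerD.
  by rewrite (snZ_ge0 sq) // ler_wpM2l // hM // jt0.
apply: le_trans (qQ _ _ _) _; first by rewrite jt0.
(* [right_deriv0] speaks of positive times only. *)
have [t00|t_gt0] := eqVneq t 0.
  by rewrite t00 sgT0 rscale0 subr0 subrr (sn0 (csn_sn cQ)) mul0r.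
by rewrite mulrC; apply: hd; rewrite hn lt_def t_gt0 t0.
Qed.

End OneSemigroup.
End Semigroup.

(** * Broken lines as approximate orbits; closedness of the generator *)

Section Chords.
Set Implicit Arguments.
Unset Strict Implicit.
Unset Printing Implicit Defensive.
Variables (R : realType) (k : scalar_kind) (X : tvsType (scalars R k)).
Variable T : R -> X -> X.
Hypothesis sgT : lequi_semigroup T.

Lemma sn_convex q (A B : X) s M : seminorm q -> 0 <= s <= 1 ->
  q A <= M -> q B <= M -> q ((1 - s) **: A + s **: B) <= M.
Proof.
move=> sq /andP[s0 s1] qA qB; apply: le_trans (snD sq _ _) _.
rewrite !(snZ_ge0 sq) ?subr_ge0 //.
have -> : M = (1 - s) * M + s * M by ring.
by apply: lerD; rewrite ler_wpM2l // subr_ge0.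
Qed.

(* The chord from [a] to [b] is an approximate orbit: telescope along [n]
   equally spaced points of it.  The remainders at these points are convex
   combinations of the remainders at [a] and [b], hence uniformly small. *)
Lemma sg_chord q Q a b ya yb L t D M : seminorm q -> csn Q ->
  (forall l x, 0 <= l <= L -> q (T l x) <= Q x) ->
  0 <= t -> 0 <= D -> t + D <= L ->
  right_deriv0 T a ya -> right_deriv0 T b yb ->
  Q (D **: ya - (b - a)) <= D * M -> Q (D **: yb - (b - a)) <= D * M ->
  q (T (t + D) a - T t b) <= D * M.
Proof.
move=> sq cQ qQ t0 D0 tDL da db Ma Mb; have sQ := csn_sn cQ.
have [D00|D_neq0] := eqVneq D 0.
  move: Ma; rewrite D00 addr0 mul0r rscale0 sub0r opprB -(sgB sgT) //.
  move=> h; apply: le_trans (qQ _ _ _) h.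
  by rewrite t0 (le_trans _ tDL) // lerDl.
have {D0 D_neq0} D0 : 0 < D by rewrite lt_def D_neq0.
apply/ler_addgt0Pr => e e0; have eD0 : 0 < e / D by rewrite divr_gt0.
have [d1 d10 hd1] := da Q _ cQ eD0; have [d2 d20 hd2] := db Q _ cQ eD0.
have [n] := small_step D (ltac:(by rewrite lt_min d10; exact: d20) : 0 < Num.min d1 d2).
move/(_ n (leqnn n)); set u := (n.+1%:R)^-1 => hn.
have u0 : 0 < u by rewrite invr_gt0.
set h := D * u in hn; have h0 : 0 < h by rewrite mulr_gt0.
have nh : n.+1%:R * h = D by rewrite mulrC divfK // pnatr_eq0.
have [nd1 nd2] : h <= d1 /\ h <= d2 by move: hn; rewrite le_min => /andP.
pose c (j : nat) := a + (j%:R * u) **: (b - a).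
(* A step of length [h] from [x] misses the chord increment by the differentiation remainder plus
   [u] times the defect of the slope. *)
have rem x y : Q (T h x - x - h **: y) <= e / D * h ->
    Q (D **: y - (b - a)) <= D * M ->
    Q (T h x - x - u **: (b - a)) <= h * (M + e / D).
  move=> h1 h2.
  have -> : T h x - x - u **: (b - a) =
     (T h x - x - h **: y) + u **: (D **: y - (b - a)).
    by rewrite (rscaleBr u (D **: y)) rscaleA (mulrC u) -/h; zmod.
  apply: le_trans (snD sQ _ _) _; rewrite (snZ_ge0 sQ) ?(ltW u0) //.
  rewrite mulrDr addrC lerD //; last by rewrite mulrC.
  by rewrite /h [D * u]mulrC -mulrA ler_wpM2l // ltW.
(* From [c j] only the time left after [j] steps has to be run; for [j = n.+1] this is [b] at time
   [t]. *)
suff H j : (j <= n.+1)%N ->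
    q (T (t + D) a - T (t + (D - j%:R * h)) (c j)) <= j%:R * h * (M + e / D).
  have cn : c n.+1 = b by rewrite /c divff ?pnatr_eq0 // rscale1 addrC subrK.
  have := H _ (leqnn _); rewrite nh subrr addr0 cn.
  by rewrite mulrDr mulrCA divff ?gt_eqF // mulr1.
elim: j => [_|j IH jn].
  by rewrite !mul0r subr0 /c mul0r rscale0 addr0 subrr (sn0 sq).
have su : 0 <= j%:R * u <= 1.
  by rewrite mulr_ge0 ?(ltW u0) // ler_pdivrMr ?ltr0n // mul1r ler_nat ltnW.
have jh : j.+1%:R * h <= D by rewrite -nh ler_wpM2r ?(ltW h0) // ler_nat.
have jh0 : 0 <= j.+1%:R * h by rewrite mulr_ge0 // ltW.
apply: le_trans (sn_tri sq (T (t + (D - j%:R * h)) (c j)) _ _) _.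
have -> : j.+1%:R * h * (M + e / D) =
    j%:R * h * (M + e / D) + h * (M + e / D) by rewrite -natr1; ring.
apply: lerD; first exact: IH (ltnW jn).
have -> : t + (D - j%:R * h) = (t + (D - j.+1%:R * h)) + h by rewrite -natr1; ring.
have tau0 : 0 <= t + (D - j.+1%:R * h) by rewrite addr_ge0 // subr_ge0.
rewrite (sgTD sgT) ?(ltW h0) // -(sgB sgT) //.
apply: le_trans (qQ _ _ _) _.
  by rewrite tau0 (le_trans _ tDL) // lerD2l gerBl.
(* The remainder is affine in the starting point, and [c j] is a convex combination of [a] and
   [b]. *)
have -> : T h (c j) - c j.+1 = (1 - j%:R * u) **: (T h a - a - u **: (b - a)) +
    (j%:R * u) **: (T h b - b - u **: (b - a)).
  rewrite rscaleBl rscale1 -addrA -[- _ + _]addrC -rscaleBr.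
  rewrite /c (sgD sgT) ?(ltW h0) // (sgZ sgT) ?(ltW h0) // -natr1 mulrDl mul1r.
  have -> : T h b - b - u **: (b - a) - (T h a - a - u **: (b - a)) =
     T h (b - a) - (b - a) by rewrite (sgB sgT) ?(ltW h0) //; zmod.
  by rewrite !(rscaleBr, rscaleDl); zmod.
by apply: sn_convex => //; [apply: rem Ma|apply: rem Mb];
  [apply: hd1|apply: hd2]; rewrite h0.
Qed.

(** The point at fraction [s] of the chord is mapped by the generator to the same convex combination
    of [ya] and [yb]. Its defect is then a convex combination too, so [sg_chord] applies with
    [s * D] for [D]. *)
Lemma sg_chord_theta q Q a b ya yb L t D M s : seminorm q -> csn Q ->
  (forall l x, 0 <= l <= L -> q (T l x) <= Q x) ->
  0 <= t -> 0 <= D -> 0 <= s <= 1 -> t + s * D <= L ->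
  right_deriv0 T a ya -> right_deriv0 T b yb ->
  Q (D **: ya - (b - a)) <= D * M -> Q (D **: yb - (b - a)) <= D * M ->
  q (T (t + s * D) a - T t (a + s **: (b - a))) <= s * D * M.
Proof.
move=> sq cQ qQ t0 D0 s01 tL da db Ma Mb; have sQ := csn_sn cQ.
have /andP[s0 s1] := s01.
apply: (@sg_chord q Q _ _ ya ((1 - s) **: ya + s **: yb) L) => //.
- by rewrite mulr_ge0.
- have -> : a + s **: (b - a) = (1 - s) **: a + s **: b.
    by rewrite rscaleBl rscale1 rscaleBr; zmod.
  by apply: right_deriv0D => //; apply: right_deriv0Z.
- rewrite [a + _]addrC addrK -rscaleA -rscaleBr (snZ_ge0 sQ) // -mulrA.
  by rewrite ler_wpM2l.
rewrite [a + _]addrC addrK -rscaleA -rscaleBr (snZ_ge0 sQ) // -mulrA ler_wpM2l //.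
have -> : D **: ((1 - s) **: ya + s **: yb) - (b - a) =
  (1 - s) **: (D **: ya - (b - a)) + s **: (D **: yb - (b - a)).
  rewrite rscaleDr !rscaleA ![D * _]mulrC -!rscaleA !rscaleBl !rscale1.
  by rewrite !rscaleBr; zmod.
exact: sn_convex.
Qed.

(** The chords are followed one after another at a cost of [D * M] each, the last one only up to the
    fraction [s]. *)
Lemma sg_broken_line q Q (a y : nat -> X) n L D M s i :
  seminorm q -> csn Q ->
  (forall l x, 0 <= l <= L -> q (T l x) <= Q x) ->
  0 <= D -> 0 <= s <= 1 -> (i < n)%N -> n%:R * D <= L ->
  (forall j, (j <= n)%N -> right_deriv0 T (a j) (y j)) ->
  (forall j, (j < n)%N -> Q (D **: y j - (a j.+1 - a j)) <= D * M /\
     Q (D **: y j.+1 - (a j.+1 - a j)) <= D * M) ->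
  q (T (i%:R * D + s * D) (a 0) - (a i + s **: (a i.+1 - a i)))
    <= (i%:R + s) * D * M.
Proof.
move=> sq cQ qQ D0 s01 lin nL da Ma; have /andP[s0 s1] := s01.
(* [t] stays general in the induction, since going back one node prolongs by [D] the time still to
   run. *)
have node j t : (j <= i)%N -> 0 <= t -> j%:R * D + t <= L ->
    q (T (j%:R * D + t) (a 0) - T t (a j)) <= j%:R * D * M.
  elim: j t => [|j IH] t ji t0 tL.
    by rewrite !mul0r add0r subrr (sn0 sq).
  apply: le_trans (sn_tri sq (T (t + D) (a j)) _ _) _.
  have E : j.+1%:R * D + t = j%:R * D + (t + D) by rewrite -natr1; ring.
  have -> : j.+1%:R * D * M = j%:R * D * M + D * M by rewrite -natr1; ring.
  rewrite E; apply: lerD; first by apply: IH (ltnW ji) _ _; rewrite -?E // addr_ge0.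
  have jn : (j < n)%N by rewrite (leq_trans ji) // ltnW.
  have [M1 M2] := Ma j jn.
  apply: (sg_chord sq cQ qQ) (da _ _) (da _ _) M1 M2 => //; last exact: ltnW.
  by apply: le_trans tL; rewrite E lerDr mulr_ge0.
have iL : i%:R * D + s * D <= L.
  apply: le_trans nL; rewrite -mulrDl ler_wpM2r //.
  by apply: (@le_trans _ _ i.+1%:R); [rewrite -natr1 lerD2l|rewrite ler_nat].
apply: le_trans (sn_tri sq (T (s * D) (a i)) _ _) _.
rewrite !mulrDl; apply: lerD; first by apply: node => //; rewrite mulr_ge0.
have [M1 M2] := Ma i lin.
rewrite -(sgT0 sgT (a i + _)) -{1}[s * D]add0r.
apply: (sg_chord_theta sq cQ qQ) (da _ _) (da _ _) M1 M2 => //; last exact: ltnW.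
by rewrite add0r (le_trans _ iL) // lerDr mulr_ge0.
Qed.

(** [sg_increment] compares with [y] itself, so [d] depends only on the orbit of [y], and the
    approximants can be chosen after [h]. *)
Lemma generator_closed x y :
  (forall q e, csn q -> 0 < e -> exists x' y',
     [/\ right_deriv0 T x' y', q (x - x') <= e & q (y - y') <= e]) ->
  right_deriv0 T x y.
Proof.
move=> cl q e cq e0; have [_ _ _ ct eqT] := sgT; have sq := csn_sn cq.
have [d d0 hd] := ct y q e cq e0.
exists d => // h /andP[h0 hhd].
have [Q cQ qQ] := eqT q h cq; have sQ := csn_sn cQ.
apply/ler_addgt0Pr => eta eta0.
have hp : 0 < h + 2 by lra.
(* Replacing [x] by [x'] costs [r] twice, replacing [y] by [y'] costs [h * r]; hence [h + 2]. *)
have [x' [y' [dx' xx' yy']]] := cl _ _ (csnD cq cQ) (divr_gt0 eta0 hp).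
set r := eta / _ in xx' yy'.
have [qx Qx] : q (x - x') <= r /\ Q (x - x') <= r.
  by split; apply: le_trans xx'; rewrite (lerDl, lerDr) sn_ge0.
have Qy : Q (y' - y) <= r.
  by rewrite (snC sQ); apply: le_trans yy'; rewrite lerDr sn_ge0.
have h01 : 0 <= h by rewrite ltW.
have inc : q (T h x' - x' - h **: y) <= h * (r + e).
  apply: (sg_increment sgT cq h01 dx') => l /andP[l0 lh].
  apply: le_trans (sn_tri sq (T l y) _ _) _; apply: lerD.
    by rewrite -(sgB sgT) //; apply: le_trans Qy; apply: qQ; rewrite l0.
  by apply: hd; rewrite l0 (le_trans lh).
have -> : T h x - x - h **: y =
    (T h (x - x') - (x - x')) + (T h x' - x' - h **: y).
  by rewrite (sgB sgT) //; zmod.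
apply: le_trans (snD sq _ _) _.
have : q (T h (x - x') - (x - x')) <= r + r.
  apply: le_trans (snD sq _ _) _; rewrite (snN sq) lerD //.
  by apply: le_trans Qx; apply: qQ; rewrite h01 lexx.
have : r * (h + 2) = eta by rewrite divfK // gt_eqF.
move: inc; lra.
Qed.

End Chords.

(** * Riemann integrals of orbits *)

Section OrbitIntegrals.
Set Implicit Arguments.
Unset Strict Implicit.
Unset Printing Implicit Defensive.
Variables (R : realType) (k : scalar_kind) (X : tvsType (scalars R k)).

Definition orbit_sum (T : R -> X -> X) (f : X) (t : R) (n : nat) : X :=
  \sum_(0 <= j < n) T (j%:R * t) f.

(** Left endpoints of [n.+1] equal subintervals, so that the mesh is defined for every [n]. *)
Definition riemann_sum T (f : X) h n : X :=
  (h / n.+1%:R) **: orbit_sum T f (h / n.+1%:R) n.+1.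

(* [v] is the Riemann integral of [T l f] over [l] in [0, h]. *)
Definition is_orbit_integral T (f : X) (h : R) (v : X) : Prop :=
  forall q e, csn q -> 0 < e -> exists N, forall n, (N <= n)%N ->
    q (v - riemann_sum T f h n) <= e.

Lemma sn_average q (F : nat -> X) n c M : seminorm q -> 0 <= c ->
  (forall j, (j < n.+1)%N -> q (F j) <= M) ->
  q ((c / n.+1%:R) **: \sum_(0 <= j < n.+1) F j) <= c * M.
Proof.
move=> sq c0 hF; rewrite (snZ_ge0 sq) ?divr_ge0 // -mulrA ler_wpM2l //.
by rewrite ler_pdivrMl ?ltr0n // sn_sum_le.
Qed.

Lemma step_mul (h : R) n : n.+1%:R * (h / n.+1%:R) = h.
Proof. by rewrite mulrC divfK // pnatr_eq0. Qed.

Lemma step_le (h : R) n j : 0 <= h -> (j < n.+1)%N ->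
  0 <= j%:R * (h / n.+1%:R) <= h.
Proof.
move=> h0 jn; rewrite mulr_ge0 ?divr_ge0 //=.
by rewrite -[leRHS](step_mul h n) ler_wpM2r ?divr_ge0 // ler_nat ltnW.
Qed.

(** Riemann sums of equal mesh are compared termwise. [T] and [T'] are arbitrary, so an orbit can
    also be compared with a constant function. *)
Lemma orbit_integral_dist T T' f f' h v v' q M : 0 <= h -> csn q ->
  is_orbit_integral T f h v -> is_orbit_integral T' f' h v' ->
  (forall r, 0 <= r <= h -> q (T r f - T' r f') <= M) -> q (v - v') <= h * M.
Proof.
move=> h0 cq iv iv' hM; have sq := csn_sn cq.
apply/ler_addgt0Pr => e e0; have e20 : 0 < e / 2 by rewrite divr_gt0.
have [N1 hN1] := iv q _ cq e20; have [N2 hN2] := iv' q _ cq e20.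
pose n := maxn N1 N2.
have H1 := hN1 n (leq_maxl _ _); have := hN2 n (leq_maxr _ _).
rewrite (snC sq) => H2.
have H3 : q (riemann_sum T f h n - riemann_sum T' f' h n) <= h * M.
  rewrite /riemann_sum /orbit_sum -rscaleBr -sumrB.
  by apply: sn_average => // j jn; apply/hM/step_le.
have := sn_tri sq (riemann_sum T f h n) v v'.
have := sn_tri sq (riemann_sum T' f' h n) (riemann_sum T f h n) v'.
lra.
Qed.

Lemma orbit_integral_cst (f : X) h : is_orbit_integral (fun _ x => x) f h (h **: f).
Proof.
move=> q e cq e0; exists 0%N => n _; rewrite /riemann_sum /orbit_sum.
rewrite sumr_const_nat subn0 -rscale_natl rscaleA divfK ?pnatr_eq0 //.
by rewrite subrr (sn0 (csn_sn cq)) ltW.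
Qed.

Variable T : R -> X -> X.
Hypothesis sgT : lequi_semigroup T.

Lemma orbit_sumS f t n : orbit_sum T f t n.+1 = orbit_sum T f t n + T (n%:R * t) f.
Proof. by rewrite /orbit_sum big_nat_recr. Qed.

Lemma orbit_sumD f t n m : 0 <= t ->
  orbit_sum T f t (n + m) = orbit_sum T f t n + T (n%:R * t) (orbit_sum T f t m).
Proof.
move=> t0; have nt0 j : 0 <= j%:R * t by rewrite mulr_ge0.
elim: m => [|m IH].
  by rewrite addn0 /orbit_sum big_nil (sg_0 sgT) // addr0.
rewrite addnS !orbit_sumS IH (sgD sgT) // -(sgTD sgT) // natrD mulrDl.
by rewrite addrA.
Qed.

(** Each coarse term is compared with its block of [m] fine terms; with [T] at the start of the
    block factored out, [f] is compared with [T r f] for small [r]. *)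
Lemma orbit_sum_refine q Q f t n m L M : seminorm q -> seminorm Q ->
  (forall l x, 0 <= l <= L -> q (T l x) <= Q x) ->
  0 <= t -> (n * m)%:R * t <= L ->
  (forall r, 0 <= r <= m%:R * t -> Q (T r f - f) <= M) ->
  q (m%:R **: orbit_sum T f (m%:R * t) n - orbit_sum T f t (n * m))
    <= (n * m)%:R * M.
Proof.
move=> sq sQ qQ t0 nL hM.
elim: n nL => [_|n IH nL].
  by rewrite mul0n /orbit_sum !big_nil rscaler0 subr0 (sn0 sq) mul0r.
have nm0 : 0 <= (n * m)%:R * t by rewrite mulr_ge0.
have nL' : (n * m)%:R * t <= L.
  by apply: le_trans nL; rewrite ler_wpM2r // ler_nat leq_mul2r leqnSn orbT.
rewrite mulSnr orbit_sumD // orbit_sumS rscaleDr mulrA -natrM opprD addrACA.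
apply: le_trans (snD sq _ _) _; rewrite natrD mulrDl; apply: lerD.
  exact: IH.
rewrite -(sgZ sgT) // -(sgB sgT) //.
apply: le_trans (qQ _ _ _) _; first by rewrite nm0.
rewrite (snC sQ) rscale_natl -[in f *+ m](subn0 m) -sumr_const_nat -sumrB.
apply: sn_sum_le => // i im; apply: hM.
by rewrite mulr_ge0 // ler_wpM2r // ler_nat ltnW.
Qed.

(** Index [n] means [n.+1] subintervals, hence the predecessor of the product. *)
Lemma riemann_sum_refine q Q f h n m M : seminorm q -> seminorm Q -> 0 <= h ->
  (forall l x, 0 <= l <= h -> q (T l x) <= Q x) ->
  (forall r, 0 <= r <= h / n.+1%:R -> Q (T r f - f) <= M) ->
  q (riemann_sum T f h n - riemann_sum T f h (n.+1 * m.+1).-1) <= h * M.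
Proof.
move=> sq sQ h0 qQ hM; rewrite /riemann_sum prednK ?muln_gt0 //.
set t := h / (n.+1 * m.+1)%:R.
have t0 : 0 <= t by rewrite divr_ge0.
have E : h / n.+1%:R = m.+1%:R * t.
  by rewrite /t natrM; field; rewrite ?nat1r ?natr1 !pnatr_eq0.
have nt : (n.+1 * m.+1)%:R * t = h by rewrite mulrC divfK // pnatr_eq0.
rewrite E {1}[m.+1%:R * t]mulrC -rscaleA -rscaleBr (snZ_ge0 sq) //.
have -> : h * M = t * ((n.+1 * m.+1)%:R * M) by rewrite -{1}nt; ring.
rewrite ler_wpM2l //.
by apply: (@orbit_sum_refine q Q f t n.+1 m.+1 h) => //; rewrite ?nt // -E.
Qed.

Lemma riemann_sum_cauchy f h q e : 0 <= h -> csn q -> 0 < e ->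
  exists N, forall n m, (N <= n)%N -> (N <= m)%N ->
    q (riemann_sum T f h n - riemann_sum T f h m) <= e.
Proof.
move=> h0 cq e0; have [_ _ _ ct eqT] := sgT; have sq := csn_sn cq.
have [Q cQ qQ] := eqT q h cq; have sQ := csn_sn cQ.
(* Both sums are compared with their common refinement, at a cost of [h] units each; the 1 keeps the
   divisor positive. *)
have h10 : 0 < h + h + 1 by lra.
have [d d0 hd] := ct f Q _ cQ (divr_gt0 e0 h10).
have [N hN] := small_step h d0.
exists N => n m Nn Nm.
have ref i j : (N <= i)%N ->
    q (riemann_sum T f h i - riemann_sum T f h (i.+1 * j.+1).-1)
    <= h * (e / (h + h + 1)).
  move=> Ni.
  apply: (@riemann_sum_refine q Q f h i j (e / (h + h + 1)) sq sQ h0 qQ) => r.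
  move=> /andP[r0 rh]; apply: hd.
  by rewrite r0 (le_trans rh) // hN.
have r1 := ref n m Nn; have := ref m n Nm; rewrite mulnC (snC sq) => r2.
apply: le_trans (sn_tri sq (riemann_sum T f h (n.+1 * m.+1).-1) _ _) _.
apply: le_trans (lerD r1 r2) _.
by rewrite -mulrDl mulrCA ler_piMr ?(ltW e0) // ler_pdivrMr // mul1r lerDl.
Qed.

(** Shifting a Riemann sum by whole mesh steps changes only its two ends, which is a discrete
    fundamental theorem of calculus. The other errors come from replacing [v] by a sum and from [u]
    not being a multiple of the mesh. *)
Lemma orbit_integral_deriv f h v : 0 < h -> is_orbit_integral T f h v ->
  right_deriv0 T v (T h f - f).
Proof.
move=> h0 iv q e cq e0; have [_ _ _ ct eqT] := sgT; have sq := csn_sn cq.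
have hge0 : 0 <= h by rewrite ltW.
set g := T h f - f.
have [Q cQ qQ] := eqT q h cq; have sQ := csn_sn cQ.
have [Q' cQ' QQ'] := eqT Q h cQ; have sQ' := csn_sn cQ'.
have [d d0 hd] := ct g q e cq e0.
exists (Num.min d h) => [|u]; first by rewrite lt_min d0.
rewrite le_min => /and3P[u0 ud uh].
have uge0 : 0 <= u by rewrite ltW.
apply/ler_addgt0Pr => eta eta0.
have K0 : 0 < h + 4 by lra.
(* Passing from [v] to [S] costs [2 * r], and the part of [u] beyond the mesh costs [h * r + r]. *)
pose r := eta / (h + 4); have r0 : 0 < r by rewrite divr_gt0.
have rE : r * (h + 4) = eta by rewrite divfK // gt_eqF.
have [d' d'0 hd'] := ct f Q' r cQ' r0.
have [N1 hN1] := small_step h d'0.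
(* Makes [t * q g], which bounds the leftover term [s **: g], at most [r]. *)
have [N2 hN2] := small_step (h * q g) r0.
have [N3 hN3] := iv _ r (csnD cq cQ) r0.
pose n := maxn N1 (maxn N2 N3).
have {}hN1 := hN1 n (leq_maxl _ _).
have {}hN2 := hN2 n (leq_trans (leq_maxl _ _) (leq_maxr _ _)).
have {}hN3 := hN3 n (leq_trans (leq_maxr _ _) (leq_maxr _ _)).
set S := riemann_sum T f h n in hN3.
set t := h / n.+1%:R in hN1.
have t0 : 0 < t by rewrite divr_gt0.
have tge0 : 0 <= t by rewrite ltW.
have ut0 : 0 <= u / t by rewrite divr_ge0.
pose j := Num.truncn (u / t).
have /andP[jut utj] := truncn_itv ut0.
rewrite -/j ler_pdivlMr // in jut; rewrite -/j ltr_pdivrMr // in utj.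
pose s := u - j%:R * t.
have s0 : 0 <= s by rewrite subr_ge0.
have st : s <= t.
  by rewrite /s lerBlDr ltW // (lt_le_trans utj) // -natr1 mulrDl mul1r addrC.
have uE : u = j%:R * t + s by rewrite addrC subrK.
have jt0 : 0 <= j%:R * t by rewrite mulr_ge0.
have jth : j%:R * t <= h by rewrite (le_trans jut).
have [qv Qv] : q (v - S) <= r /\ Q (v - S) <= r.
  by split; apply: le_trans hN3; rewrite (lerDl, lerDr) sn_ge0.
have shift : T (j%:R * t) S - S = t **: \sum_(0 <= i < j) T (i%:R * t) g.
  rewrite /S /riemann_sum -/t (sgZ sgT) // -rscaleBr; congr (_ **: _).
  (* A sum of [n.+1 + j] terms is split after [j] and after [n.+1] terms; [n.+1] steps make up the
     time [h]. *)
  have := orbit_sumD f n.+1 j tge0; rewrite addnC orbit_sumD // step_mul => H.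
  have -> : T (j%:R * t) (orbit_sum T f t n.+1) =
      orbit_sum T f t n.+1 + T h (orbit_sum T f t j) - orbit_sum T f t j.
    by rewrite -H; zmod.
  rewrite [_ + T h _]addrC -addrA [- _ + _]addrC addrA addrK.
  rewrite /orbit_sum (sg_sum sgT) // -sumrB; apply: eq_bigr => i _.
  have it0 : 0 <= i%:R * t by rewrite mulr_ge0.
  by rewrite /g (sgB sgT) // -!(sgTD sgT) // [h + _]addrC.
have main : q (T (j%:R * t) S - S - u **: g) <= e * (j%:R * t) + r.
  have -> : T (j%:R * t) S - S - u **: g =
      t **: (\sum_(0 <= i < j) (T (i%:R * t) g - g)) - s **: g.
    rewrite shift uE rscaleDl sumrB [t **: (_ - _)]rscaleBr sumr_const_nat subn0.
    by rewrite -rscale_natl rscaleA (mulrC t) opprD addrA.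
  apply: le_trans (snD sq _ _) _; rewrite (snN sq) !(snZ_ge0 sq) //.
  apply: lerD; last first.
    by apply: le_trans hN2; rewrite -/t mulrAC -/t ler_wpM2r // sn_ge0.
  have -> : e * (j%:R * t) = t * (j%:R * e) by ring.
  rewrite ler_wpM2l //.
  apply: sn_sum_le => // i ij; apply: hd; rewrite mulr_ge0 //=.
  by apply: le_trans ud; apply: le_trans jut; rewrite ler_wpM2r // ler_nat ltnW.
(* [T s f - f] is moved by [T (i%:R * t)] and then by [T (j%:R * t)], hence the two bounds [Q'] and
   [Q]. *)
have tail : q (T u S - T (j%:R * t) S) <= h * r.
  rewrite uE (sgTD sgT) // -(sgB sgT) //.
  apply: le_trans (qQ _ _ _) _; first by rewrite jt0.
  rewrite /S /riemann_sum (sgZ sgT) // -rscaleBr /orbit_sum (sg_sum sgT) // -sumrB.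
  apply: sn_average => // i ii; rewrite -/t.
  have it0 : 0 <= i%:R * t by rewrite mulr_ge0.
  rewrite -(sgTD sgT) // [s + _]addrC (sgTD sgT) // -(sgB sgT) //.
  apply: le_trans (QQ' _ _ _) _; first by rewrite /t step_le.
  by apply: hd'; rewrite s0 (le_trans st).
have lead : q (T u (v - S)) <= r by apply: le_trans Qv; apply: qQ; rewrite uge0.
have -> : T u v - v - u **: g = T u (v - S) - (v - S) +
   ((T u S - T (j%:R * t) S) + (T (j%:R * t) S - S - u **: g)).
  by rewrite (sgB sgT) //; zmod.
have := snD sq (T u (v - S) - (v - S))
   ((T u S - T (j%:R * t) S) + (T (j%:R * t) S - S - u **: g)).
have := snD sq (T u (v - S)) (- (v - S)); rewrite (snN sq).
have := snD sq (T u S - T (j%:R * t) S) (T (j%:R * t) S - S - u **: g).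
have : e * (j%:R * t) <= e * u by rewrite ler_wpM2l // ltW.
lra.
Qed.

(** [h **: f] is the integral of the constant function, with which the orbit is compared. *)
Lemma orbit_integral_near f h q v e : 0 < h -> csn q ->
  is_orbit_integral T f h v ->
  (forall r, 0 <= r <= h -> q (T r f - f) <= e) -> q (h^-1 **: v - f) <= e.
Proof.
move=> h0 cq iv he; have sq := csn_sn cq.
have := orbit_integral_dist (ltW h0) cq iv (orbit_integral_cst f h) he.
have -> : h^-1 **: v - f = h^-1 **: (v - h **: f).
  by rewrite rscaleBr rscaleA mulVf ?gt_eqF // rscale1.
by rewrite (snZ_ge0 sq) ?invr_ge0 ?(ltW h0) // ler_pdivrMl.
Qed.

Variables (Omega : Type) (p : Omega -> X -> R).
Hypothesis X_gen : generated_by_seminorms p.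
Hypothesis X_complete : sequentially_complete X.

(** Equal subdivisions give a Cauchy sequence, to which sequential completeness applies. *)
Lemma orbit_integral_exists f h : 0 <= h -> exists v, is_orbit_integral T f h v.
Proof.
move=> h0; have [|v cv] := X_complete (u := riemann_sum T f h).
  move=> E /(entourage_csn X_gen)[q cq [e e0 hE]].
  have e20 : 0 < e / 2 by rewrite divr_gt0.
  have [N hN] := riemann_sum_cauchy f h0 cq e20.
  exists ([set x | exists2 n, (N <= n)%N & x = riemann_sum T f h n],
          [set x | exists2 n, (N <= n)%N & x = riemann_sum T f h n]) => /=.
    by split; exists N => // n Nn; exists n.
  move=> [x y] /= [[n Nn ->] [m Nm ->]]; apply: hE.
  by apply: le_lt_trans (hN _ _ Nn Nm) _; exact: half_lt.
exists v => q e cq e0; have [N _ hN] := csn_cvg cq cv e0.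
by exists N => n /hN /ltW.
Qed.
End OrbitIntegrals.

(** * Generators and uniform convergence in terms of seminorms *)

Section Bridge.
Set Implicit Arguments.
Unset Strict Implicit.
Unset Printing Implicit Defensive.
Variables (R : realType) (k : scalar_kind) (X : tvsType (scalars R k)).
Variables (Omega : Type) (p : Omega -> X -> R).
Hypothesis X_gen : generated_by_seminorms p.

Lemma near_right0P (P : R -> Prop) :
  (\forall s \near 0^'+, P s) <->
  exists2 d, 0 < d & forall s, 0 < s <= d -> P s.
Proof.
split=> [|[d d0 hd]].
  rewrite near_withinE => /nbhs_ballP[e /= e0 he].
  exists (e / 2); first by rewrite divr_gt0.
  move=> s /andP[s0 se]; apply: he => //; rewrite /ball /= sub0r normrN gtr0_norm //.
  by apply: le_lt_trans se _; exact: half_lt.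
near=> s; apply: hd; apply/andP; split; near: s.
  exact: nbhs_right_gt.
by apply: nbhs_right_le.
Unshelve. all: by end_near. Qed.

(** Evaluation at [x] is continuous for pointwise convergence, which gives continuity at 0; the
    local bound comes from first powers. *)
Lemma lC0_lequi (T : R -> X -> X) : lC0_semigroup p T -> lequi_semigroup T.
Proof.
move=> [ct T0 TD [bT _ eT]]; split=> //.
- by move=> l /bT[].
- move=> x q e cq e0.
  have in0 : `[0, +oo[%classic (0 : R) by rewrite /= in_itv /= lexx.
  have := (subspace_continuousP _ _).1 ct 0 in0.
  move=> /cvg_comp /(_ (@proj_continuous _ (fun=> X) x (T 0))) cvgT.
  have FF : Filter (within `[0, +oo[%classic (nbhs (0 : R))).
    by apply: within_filter.
  have := [elaborate csn_cvg cq cvgT e0].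
  rewrite near_withinE => /nbhs_ballP[d /= d0 hd].
  exists (d / 2); first by rewrite divr_gt0.
  move=> h /andP[h0 hd2]; rewrite -{2}(_ : T 0 x = x) ?T0 // (snC (csn_sn cq)) -T0 ltW //.
  apply: hd; last by rewrite /= in_itv /= h0.
  rewrite /ball /= sub0r normrN ger0_norm //.
  by apply: le_lt_trans hd2 _; exact: half_lt.
(* [class_E] gives equicontinuity for nonnegative bounds, hence [Num.max 0 L]. *)
move=> q L cq; have L0 : 0 <= Num.max 0 L by rewrite le_max lexx.
have [Q cQ hQ] := csn_equi X_gen (eT _ L0) cq.
exists Q => // l x /andP[l0 lL]; apply: hQ.
exists 1%N, 1%N, l; split=> //; last by rewrite divr1.
by rewrite mul1r divr1 le_max lL orbT.
Qed.

Hypothesis X_hausdorff : hausdorff_space X.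

(** Multiplication by [h] turns the error of the difference quotient into the remainder; uniqueness
    of limits identifies [y] with [Z x]. *)
Lemma generator_right_deriv0P T (Z : operator X) x y : generator_of T Z ->
  right_deriv0 T x y <-> op_dom Z x /\ Z x = y.
Proof.
move=> [domZ cvZ].
have quot y' h q : seminorm q -> 0 < h ->
    q (T h x - x - h **: y') = h * q (y' - of_real k h^-1 *: (T h x - x)).
  move=> sq h0; rewrite (snC sq) -[of_real _ _ *: _]/(rscale _ _).
  rewrite -(snZ_ge0 sq) ?ltW // rscaleBr rscaleA divff ?gt_eqF // rscale1.
  by rewrite (snC sq).
have cvgE y' : of_real k h^-1 *: (T h x - x) @[h --> 0^'+] --> y' <->
    right_deriv0 T x y'.
  split=> [cv q e cq e0|dx].
    have /near_right0P[d d0 hd] := [elaborate csn_cvg cq cv e0].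
    exists d => // h /[dup] /andP[h0 _] /hd hq.
    by rewrite (quot _ _ _ (csn_sn cq)) // mulrC ler_wpM2r // ltW.
  apply: (cvg_csnP X_gen) => q e cq e0; apply/near_right0P.
  have e20 : 0 < e / 2 by rewrite divr_gt0.
  have [d d0 hd] := dx q _ cq e20; exists d => // h /[dup] /andP[h0 _] /hd.
  rewrite (quot _ _ _ (csn_sn cq)) // mulrC ler_pM2r // => /le_lt_trans; apply.
  exact: half_lt.
split=> [/cvgE cvx|[dx <-]]; last by apply/cvgE/cvZ.
have dx : op_dom Z x by rewrite domZ; exists y.
by split => //; apply: cvg_unique X_hausdorff _ _ _ _ (cvZ _ dx) cvx.
Qed.

Lemma uniform_csnP (A : set R) (u : R -> R -> X) (v : R -> X) :
  {uniform A, u @ 0^'+ --> v} <->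
  forall q e, csn q -> 0 < e ->
    \forall s \near 0^'+, forall l, A l -> q (v l - u s l) < e.
Proof.
split=> [cv q e [_ cq] e0|
    h P /uniform_nbhs[E [/(entourage_csn X_gen)[q cq [e e0 hE]] EP]]].
  apply: (cv [set w : {uniform` A -> X} | forall l, A l -> q (v l - w l) < e]).
  by apply/uniform_nbhs; exists [set xy | q (xy.1 - xy.2) < e]; split => //; exact: cq.
apply: filterS (h q e cq e0) => s hs; apply: EP => l Al; apply: hE; exact: hs.
Qed.

End Bridge.

(** * Convergence of a family of semigroups *)

Section Family.
Set Implicit Arguments.
Unset Strict Implicit.
Unset Printing Implicit Defensive.
Variables (R : realType) (k : scalar_kind) (X : tvsType (scalars R k)).

Lemma common_radius (P : nat -> R -> Prop) n :
  (forall j, exists2 d : R, 0 < d & forall s, 0 < s <= d -> P j s) ->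
  exists2 d : R, 0 < d & forall s, 0 < s <= d -> forall j, (j <= n)%N -> P j s.
Proof.
move=> hP; elim: n => [|n [d d0 hd]].
  by have [d d0 hd] := hP 0%N; exists d => // s /hd Ps j; rewrite leqn0 => /eqP ->.
have [d' d'0 hd'] := hP n.+1; exists (Num.min d d').
  by rewrite lt_min d0.
move=> s; rewrite le_min => /and3P[s0 sd sd'] j; rewrite leq_eqVlt => /orP[/eqP ->|jn].
  by apply: hd'; rewrite s0.
by apply: hd jn; rewrite s0.
Qed.

(** Means of the orbit of [f] over short intervals serve as approximants. *)
Lemma domain_dense (T : R -> X -> X) (Omega : Type) (p : Omega -> X -> R) :
  generated_by_seminorms p -> sequentially_complete X -> lequi_semigroup T ->
  forall f q e, csn q -> 0 < e ->
    exists x y, right_deriv0 T x y /\ q (f - x) <= e.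
Proof.
move=> X_gen X_complete sgT f q e cq e0; have [_ _ _ ct _] := sgT.
have [h h0 hh] := ct f q e cq e0.
have [v iv] := orbit_integral_exists sgT X_gen X_complete f (ltW h0).
exists (h^-1 **: v), (h^-1 **: (T h f - f)); split.
  by apply: right_deriv0Z => //; exact: orbit_integral_deriv.
by rewrite (snC (csn_sn cq)); apply: orbit_integral_near iv _.
Qed.

Variable T : R -> R -> X -> X.
Hypothesis sgT : forall s, 0 <= s -> lequi_semigroup (T s).
Hypothesis eqT : forall q L, csn q -> exists2 Q, csn Q &
  forall s l x, 0 <= s -> 0 <= l <= L -> q (T s l x) <= Q x.

(** Weaker than membership in [limit_domain]: the approximants may depend on [q] and [e]. This form
    survives closure in the graph, so it reaches the whole domain when [limit_domain] is a core. *)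
Definition liftable (x z : X) : Prop :=
  forall q e, csn q -> 0 < e -> exists2 d, 0 < d & forall s, 0 < s <= d ->
    exists ab, [/\ right_deriv0 (T s) ab.1 ab.2, q (x - ab.1) <= e & q (z - ab.2) <= e].

(* Constant 7: 5 for the defect of the broken line through the [a j], 1 for
   [T s l (w 0 - a 0)] and 1 for the distance between the two broken lines. *)
Lemma shadow_orbit q Q (w z a b : nat -> X) n t0 M s l :
  0 <= s -> csn q -> csn Q -> 0 <= M -> 0 < t0 ->
  (forall l x, 0 <= l <= t0 + t0 -> q (T s l x) <= Q x) ->
  let D := t0 / n.+1%:R in
  (forall j, (j < n.+2)%N -> Q (D **: z j - (w j.+1 - w j)) <= D * M) ->
  (forall j, (j < n.+2)%N -> Q (z j.+1 - z j) <= M) ->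
  (forall j, (j <= n.+2)%N ->
     [/\ right_deriv0 (T s) (a j) (b j), Q (w j - a j) <= D * M & Q (z j - b j) <= M]) ->
  0 <= l <= t0 ->
  forall i, i = Num.truncn (l / D) ->
  q (T s l (w 0%N) - (w i + (l / D - i%:R) **: (w i.+1 - w i))) <= 7 * (t0 * M).
Proof.
move=> s0 cq cQ M0 t00 qQ D hw hz hab lint i iE.
have /andP[l0 lt] := lint.
have sq := csn_sn cq; have sQ := csn_sn cQ; have sg := sgT s0.
have D0 : 0 < D by rewrite divr_gt0.
have nD : n.+1%:R * D = t0 by rewrite step_mul.
have Dt : D <= t0 by rewrite ler_pdivrMr // ler_peMr ?(ltW t00) // ler1n.
have DM0 : 0 <= D * M by rewrite mulr_ge0 // ltW.
have lD0 : 0 <= l / D by rewrite divr_ge0 // ltW.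
have /andP[il li] := truncn_itv lD0; rewrite -iE in il li.
set th := l / D - i%:R.
have th01 : 0 <= th <= 1.
  by rewrite subr_ge0 il lerBlDl ltW // natr1.
have lE : l = i%:R * D + th * D.
  by rewrite -mulrDl addrC subrK divfK // gt_eqF.
(* For [l = t0] the index is [n.+1], and a chord beyond [t0] occurs; hence the nodes up to [n.+2]
   and the time bound [t0 + t0]. *)
have iin : (i < n.+2)%N.
  rewrite ltnS -(ler_nat R); apply: le_trans il _.
  by rewrite ler_pdivrMr // nD.
have qleQ x : q x <= Q x.
  by rewrite -{1}(sgT0 sg x); apply: qQ; rewrite lexx addr_ge0 // ltW.
have line j : (j < n.+2)%N -> Q (D **: b j - (a j.+1 - a j)) <= D * (5 * M) /\
     Q (D **: b j.+1 - (a j.+1 - a j)) <= D * (5 * M).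
  move=> jn; have [_ aj bj] := hab j (ltnW jn); have [_ aj1 bj1] := hab j.+1 jn.
  (* In units of [D * M]: 2 from [x - z j], 1 from the chord of [w], 2 from its two end nodes. *)
  have gap x : Q (z j - x) <= M + M -> Q (D **: x - (a j.+1 - a j)) <= D * (5 * M).
    move=> zx.
    have -> : D **: x - (a j.+1 - a j) = D **: (x - z j) +
        (D **: z j - (w j.+1 - w j)) + ((w j.+1 - a j.+1) - (w j - a j)).
      by rewrite [D **: (x - _)]rscaleBr; zmod.
    apply: le_trans (snD sQ _ _) _.
    have h1 := snD sQ (D **: (x - z j)) (D **: z j - (w j.+1 - w j)).
    have h2 := snD sQ (w j.+1 - a j.+1) (- (w j - a j)).
    rewrite (snN sQ) in h2.
    have h3 : Q (D **: (x - z j)) <= D * (M + M).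
      by rewrite (snZ_ge0 sQ) ?(ltW D0) // (snC sQ) ler_wpM2l // ltW.
    have h4 := hw j jn.
    rewrite mulrDr in h3; lra.
  split; apply: gap; first by lra.
  apply: le_trans (sn_tri sQ (z j.+1) _ _) _.
  by rewrite lerD // (snC sQ) hz.
have nL : n.+2%:R * D <= t0 + t0 by rewrite -natr1 mulrDl mul1r nD lerD2l.
have dab j : (j <= n.+2)%N -> right_deriv0 (T s) (a j) (b j) by case/hab.
have main := sg_broken_line sg sq cQ qQ (ltW D0) th01 iin nL dab line.
rewrite -lE in main.
have lM : (i%:R + th) * D * (5 * M) <= 5 * (t0 * M).
  by rewrite mulrDl -lE mulrCA ler_wpM2l // ler_wpM2r.
have t0M : D * M <= t0 * M by rewrite ler_wpM2r.
have start : q (T s l (w 0%N) - T s l (a 0%N)) <= D * M.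
  rewrite -(sgB sg) //; have [_ h _] := hab 0%N isT; apply: le_trans h.
  by apply: qQ; rewrite l0 (le_trans lt) // lerDl ltW.
have close : q (a i + th **: (a i.+1 - a i) - (w i + th **: (w i.+1 - w i))) <= D * M.
  have -> : a i + th **: (a i.+1 - a i) - (w i + th **: (w i.+1 - w i)) =
     (1 - th) **: (a i - w i) + th **: (a i.+1 - w i.+1).
    by rewrite (rscaleBl 1 th) rscale1 !rscaleBr; zmod.
  by apply: sn_convex => //; rewrite (snC sq); apply: le_trans (qleQ _) _;
    [case: (hab i (ltnW iin))|case: (hab i.+1 iin)].
apply: le_trans (sn_tri sq (T s l (a 0%N)) _ _) _.
have := sn_tri sq (a i + th **: (a i.+1 - a i)) (T s l (a 0%N))
  (w i + th **: (w i.+1 - w i)).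
lra.
Qed.

(** The mesh is fixed by the orbit under [T 0] alone, so only finitely many nodes are lifted, for
    all small [s] at once. The broken line through the [w j] then follows both orbits. *)
Lemma liftable_cvg f y : right_deriv0 (T 0) f y ->
  (forall x z, right_deriv0 (T 0) x z -> liftable x z) ->
  forall q e t0, csn q -> 0 < e -> 0 < t0 ->
    exists2 d, 0 < d & forall s, 0 < s <= d -> forall l, 0 <= l <= t0 ->
      q (T 0 l f - T s l f) <= e.
Proof.
move=> df lift q e t0 cq e0 t00; have sq := csn_sn cq.
have t00' : 0 < t0 + t0 by rewrite addr_gt0.
have [Q cQ qQ] := eqT (t0 + t0) cq; have sQ := csn_sn cQ.
have [Q' cQ' QQ'] := eqT (t0 + t0) cQ; have sQ' := csn_sn cQ'.
have sg0 := sgT (lexx 0); have [_ _ _ ct _] := sg0.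
(* [shadow_orbit] is used twice, at a cost of [7 * (t0 * M)] each. *)
pose M := e / (14 * t0); have M0 : 0 < M by rewrite divr_gt0 // mulr_gt0.
have Me : 14 * (t0 * M) = e by rewrite mulrA mulrC divfK // gt_eqF // mulr_gt0.
(* [Q'] controls these errors after they are carried along by [T 0 (j%:R * D)]. *)
have [d1 d10 hd1] := df Q' M cQ' M0.
have [d2 d20 hd2] := ct y Q' M cQ' M0.
have dd0 : 0 < Num.min d1 d2 by rewrite lt_min d10.
have [n /(_ n (leqnn n))] := small_step t0 dd0.
rewrite le_min => /andP[nd1 nd2].
set D := t0 / n.+1%:R in nd1 nd2.
have D0 : 0 < D by rewrite divr_gt0.
have nL j : (j < n.+2)%N -> 0 <= j%:R * D <= t0 + t0.
  move=> jn; rewrite mulr_ge0 ?(ltW D0) //=; apply: (@le_trans _ _ t0).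
    by rewrite -[leRHS](step_mul t0 n) ler_wpM2r ?(ltW D0) // ler_nat.
  by rewrite lerDl ltW.
pose w (j : nat) := T 0 (j%:R * D) f; pose z (j : nat) := T 0 (j%:R * D) y.
have jD0 (j : nat) : 0 <= j%:R * D by rewrite mulr_ge0 // ltW.
have wS j x : T 0 (j.+1%:R * D) x = T 0 (j%:R * D) (T 0 D x).
  by rewrite -natr1 mulrDl mul1r (sgTD sg0) // ltW.
have hw j : (j < n.+2)%N -> Q (D **: z j - (w j.+1 - w j)) <= D * M.
  move=> jn; rewrite (snC sQ) /w /z wS -!(sgB sg0) // -(sgZ sg0) // -(sgB sg0) //.
  apply: le_trans (QQ' _ _ _ _ _) _ => //; first exact: nL.
  by rewrite mulrC; apply: hd1; rewrite D0.
have hz j : (j < n.+2)%N -> Q (z j.+1 - z j) <= M.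
  move=> jn; rewrite /z wS -(sgB sg0) //.
  apply: le_trans (QQ' _ _ _ _ _) _ => //; first exact: nL.
  by apply: hd2; rewrite (ltW D0).
(* In the slope of a chord an error of a node is divided by [D], so nodes are met within [D * M]. *)
have eps0 : 0 < Num.min M (D * M) by rewrite lt_min M0 mulr_gt0.
have dw j : right_deriv0 (T 0) (w j) (z j) by exact: right_deriv0T.
have [d d0 hd] := common_radius n.+2 (fun j => lift _ _ (dw j) Q _ cQ eps0).
exists d => // s sd l lt0; have s0 : 0 <= s by case/andP: sd => /ltW.
have /choice[ab hab] : forall j, exists ab, (j <= n.+2)%N ->
    [/\ right_deriv0 (T s) ab.1 ab.2, Q (w j - ab.1) <= Num.min M (D * M) &
        Q (z j - ab.2) <= Num.min M (D * M)].
  move=> j; have [jn|jn] := leqP j n.+2; last by exists (0, 0).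
  by have [ab ?] := hd s sd j jn; exists ab.
have w0 : w 0%N = f by rewrite /w mul0r (sgT0 sg0).
have Hs := @shadow_orbit q Q w z (fun j => (ab j).1) (fun j => (ab j).2) n t0 M s l
  s0 cq cQ (ltW M0) t00 (fun l x => qQ s l x s0) hw hz.
(* At [s = 0] the nodes lift to themselves. *)
have H0 := @shadow_orbit q Q w z w z n t0 M 0 l
  (lexx 0) cq cQ (ltW M0) t00 (fun l x => qQ 0 l x (lexx 0)) hw hz.
rewrite w0 in Hs H0.
pose i := Num.truncn (l / D).
apply: le_trans (sn_tri sq (w i + (l / D - i%:R) **: (w i.+1 - w i)) _ _) _.
have -> : e = 7 * (t0 * M) + 7 * (t0 * M) by rewrite -Me; ring.
apply: lerD.
  apply: (fun h => H0 h lt0 _ erefl) => j _.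
  by split=> //; rewrite subrr (sn0 sQ) ?(ltW M0) // mulr_ge0 ?(ltW M0) ?(ltW D0).
rewrite (snC sq); apply: (fun h => Hs h lt0 _ erefl) => j jn.
have [? ] := hab j jn; rewrite !le_min => /andP[_ ?] /andP[? _].
by split.
Qed.

End Family.

(** * The two implications *)

Section Main.
Set Implicit Arguments.
Unset Strict Implicit.
Unset Printing Implicit Defensive.
Variables (R : realType) (k : scalar_kind) (X : tvsType (scalars R k)).
Variables (Omega : Type) (p : Omega -> X -> R).
Hypothesis X_gen : generated_by_seminorms p.
Hypothesis X_hausdorff : hausdorff_space X.
Hypothesis X_complete : sequentially_complete X.
Variables (Z : R -> operator X) (T : R -> R -> X -> X).
Hypothesis sgT : forall s, 0 <= s -> lequi_semigroup (T s).
Hypothesis genT : forall s, 0 <= s -> generator_of (T s) (Z s).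
Hypothesis eqT : forall q L, csn q -> exists2 Q, csn Q &
  forall s l x, 0 <= s -> 0 <= l <= L -> q (T s l x) <= Q x.

Let genP s x y (s0 : 0 <= s) :=
  generator_right_deriv0P X_gen X_hausdorff x y (genT s0).

(** Two approximations in the graph: of [x] by some [g] in the core, then of [g] by its family
    [fs]. *)
Lemma core_liftable : core (Z 0) (limit_domain Z) ->
  forall x z, right_deriv0 (T 0) x z -> liftable T x z.
Proof.
move=> [_ clD] x z dx q e cq e0; have sq := csn_sn cq.
have e20 : 0 < e / 2 by rewrite divr_gt0.
have /(genP _ _ (lexx 0))[domx Zx] := dx.
have : op_graph (Z 0) (x, z) by exists x => //; rewrite Zx.
rewrite -clD => /(csn_closureP X_gen)/(_ q _ cq e20).
move=> [_ [g [domg [fs [domfs fsg Zfsg]]] <-] /= [xg zg]].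
have /near_right0P[d d0 hd] : \forall s \near 0^'+,
    q (g - fs s) < e / 2 /\ q (Z 0 g - Z s (fs s)) < e / 2.
  by apply: filterI; [exact: csn_cvg cq fsg e20|exact: csn_cvg cq Zfsg e20].
exists d => // s sd; have [gs zs] := hd s sd; have /andP[s0 _] := sd.
exists (fs s, Z s (fs s)); split => /=.
- by apply/(genP _ _ (ltW s0)); split => //; exact: domfs.
- by apply: le_trans (sn_tri sq g _ _) _; rewrite [e]splitr lerD // ltW.
by apply: le_trans (sn_tri sq (Z 0 g) _ _) _; rewrite [e]splitr lerD // ltW.
Qed.

(** Density of the domain and the bound uniform in [s] extend the convergence to all [f]. *)
Lemma core_cvg : core (Z 0) (limit_domain Z) ->
  forall f q e t0, csn q -> 0 < e -> 0 < t0 ->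
    exists2 d, 0 < d & forall s, 0 < s <= d -> forall l, 0 <= l <= t0 ->
      q (T 0 l f - T s l f) <= e.
Proof.
move=> coreD f q e t0 cq e0 t00; have sq := csn_sn cq.
have e30 : 0 < e / 3 by rewrite divr_gt0.
have [Q cQ qQ] := eqT t0 cq; have sQ := csn_sn cQ.
have [x [y [dx fx]]] := domain_dense X_gen X_complete (sgT (lexx 0)) f cQ e30.
have [d d0 hd] := liftable_cvg sgT eqT dx (core_liftable coreD) cq e30 t00.
exists d => // s sd l lt0; have l0 : 0 <= l by case/andP: lt0.
have s0 : 0 <= s by case/andP: sd => /ltW.
have close r : 0 <= r -> q (T r l f - T r l x) <= e / 3.
  by move=> r0; rewrite -(sgB (sgT r0)) //; apply: le_trans fx; apply: qQ.
apply: le_trans (sn_tri sq (T 0 l x) _ _) _.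
have -> : e = e / 3 + (e / 3 + e / 3) by field.
apply: lerD; first exact: close.
apply: le_trans (sn_tri sq (T s l x) _ _) _; apply: lerD; first exact: hd.
by rewrite (snC sq) close.
Qed.

(** One inclusion is closedness of [Z 0]. For the other, the means of the orbits of [x] under the
    [T s] form the family that [limit_domain] asks for. *)
Lemma cvg_core :
  (forall f q e t0, csn q -> 0 < e -> 0 < t0 ->
    \forall s \near 0^'+, forall l, 0 <= l <= t0 -> q (T 0 l f - T s l f) < e) ->
  core (Z 0) (limit_domain Z).
Proof.
move=> cv; split; first by move=> x [].
rewrite eqEsubset; split => [[x y] /(csn_closureP X_gen) clxy|_ [x domx <-]].
  have : right_deriv0 (T 0) x y.
    apply: (generator_closed (sgT (lexx 0))) => q e cq e0.
    have [_ [z [domz _] <-] /= [xz yz]] := clxy q e cq e0.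
    exists z, (Z 0 z); split; [|exact: ltW|exact: ltW].
    exact/(genP _ _ (lexx 0)).
  by move=> /(genP _ _ (lexx 0))[domx <-]; exists x.
apply/(csn_closureP X_gen) => q e cq e0; have sq := csn_sn cq.
have dx : right_deriv0 (T 0) x (Z 0 x) by exact/(genP _ _ (lexx 0)).
have e20 : 0 < e / 2 by rewrite divr_gt0.
have [_ _ _ ct _] := sgT (lexx 0).
have [d1 d10 hd1] := dx q _ cq e20; have [d2 d20 hd2] := ct x q _ cq e20.
(* [d1] brings the image of the mean near [Z 0 x], [d2] the mean near [x]. *)
pose h := Num.min d1 d2; have h0 : 0 < h by rewrite lt_min d10.
have /choice[v hv] : forall s, exists v, 0 <= s -> is_orbit_integral (T s) x h v.
  (* Negative indices get the dummy value 0. *)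
  move=> s; case: (leP 0 s) => [s0|_]; last by exists 0.
  by have [v ?] := orbit_integral_exists (sgT s0) X_gen X_complete x (ltW h0); exists v.
have dv s : 0 <= s -> right_deriv0 (T s) (h^-1 **: v s) (h^-1 **: (T s h x - x)).
  move=> s0; apply: (right_deriv0Z (sgT s0)).
  exact: (orbit_integral_deriv (sgT s0) h0 (hv s s0)).
have [dom0 Z0] := (genP _ _ (lexx 0)).1 (dv 0 (lexx 0)).
have near_h q' e' : csn q' -> 0 < e' -> \forall s \near 0^'+,
   0 < s /\ forall l, 0 <= l <= h -> q' (T 0 l x - T s l x) < e'.
  by move=> cq' e'0; apply: filterI; [exact: nbhs_right_gt|exact: cv].
exists (h^-1 **: v 0, Z 0 (h^-1 **: v 0)); last first.
  rewrite /= Z0; split.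
    rewrite (snC sq); apply: le_lt_trans (_ : e / 2 < e); last first.
      exact: half_lt.
    apply: (orbit_integral_near h0 cq (hv 0 (lexx 0))) => r /andP[r0 rh].
    by apply: hd2; rewrite r0 (le_trans rh) // ge_min lexx orbT.
  rewrite (snC sq); apply: le_lt_trans (_ : e / 2 < e); last first.
    exact: half_lt.
  have -> : h^-1 **: (T 0 h x - x) - Z 0 x =
      h^-1 **: (T 0 h x - x - h **: Z 0 x).
    by rewrite (rscaleBr _ (T 0 h x - x)) rscaleA mulVf ?gt_eqF // rscale1.
  rewrite (snZ_ge0 sq) ?invr_ge0 ?(ltW h0) // ler_pdivrMl // mulrC.
  by apply: hd1; rewrite h0 ge_min lexx.
exists (h^-1 **: v 0) => //; split=> //.
exists (fun s => h^-1 **: v s); split.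
- by move=> s /ltW s0; have [] := (genP _ _ s0).1 (dv s s0).
- apply: (cvg_csnP X_gen) => q' e' cq' e'0; have sq' := csn_sn cq'.
  have e'20 : 0 < e' / 2 by rewrite divr_gt0.
  apply: filterS (near_h q' _ cq' e'20) => s [s0 hs].
  apply: le_lt_trans (_ : e' / 2 < e'); last first.
    exact: half_lt.
  rewrite -rscaleBr (snZ_ge0 sq') ?invr_ge0 ?(ltW h0) // ler_pdivrMl //.
  apply: (orbit_integral_dist (ltW h0) cq' (hv 0 (lexx 0)) (hv s (ltW s0))).
  by move=> r /hs /ltW.
apply: (cvg_csnP X_gen) => q' e' cq' e'0; have sq' := csn_sn cq'.
apply: filterS (near_h q' _ cq' (mulr_gt0 h0 e'0)) => s [s0 hs].
have [_ Zs] := (genP _ _ (ltW s0)).1 (dv s (ltW s0)).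
(* [x] cancels, which leaves the convergence at the single time [h]. *)
rewrite Z0 Zs -rscaleBr opprB addrA subrK.
rewrite (snZ_ge0 sq') ?invr_ge0 ?(ltW h0) // ltr_pdivrMl //.
by apply: hs; rewrite lexx (ltW h0).
Qed.

End Main.

Theorem theorem6p2 (R : realType) (k : scalar_kind)
    (X : tvsType (scalars R k)) (Omega : Type) (p : Omega -> X -> R)
    (X_gen : generated_by_seminorms p) (X_hausdorff : hausdorff_space X)
    (X_complete : sequentially_complete X)
    (Z : R -> operator X)
    (expZ : R -> R -> X -> X) (* expZ s l is exp(l Z_s) *)
    (expZ_semigroup : forall s, 0 <= s -> lC0_semigroup p (expZ s))
    (expZ_generator : forall s, 0 <= s -> generator_of (expZ s) (Z s))
    (expZ_equicontinuous : forall l0 : R, 0 <= l0 ->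
       seminorm_equicontinuous p
         [set G | exists l s, [/\ 0 <= l <= l0, 0 <= s & G = expZ s l]]) :
  (forall (t0 : R) (f : X), 0 < t0 ->
     {uniform `[0, t0], (fun s l => expZ s l f) @ 0^'+ --> (fun l => expZ 0 l f)})
  <-> core (Z 0) (limit_domain Z).
Proof.
have sgT s (s0 : 0 <= s) := lC0_lequi X_gen (expZ_semigroup s s0).
have eqT q L : csn q -> exists2 Q, csn Q &
    forall s l x, 0 <= s -> 0 <= l <= L -> q (expZ s l x) <= Q x.
  move=> cq; have L0 : 0 <= Num.max 0 L by rewrite le_max lexx.
  have [Q cQ hQ] := csn_equi X_gen (expZ_equicontinuous _ L0) cq.
  exists Q => // s l x s0 /andP[l0 lL]; apply: hQ.
  by exists l, s; split=> //; rewrite l0 le_max lL orbT.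
split=> [cv|coreD t0 f t00].
  apply: (cvg_core X_gen X_hausdorff X_complete sgT expZ_generator).
  move=> f q e t0 cq e0 t00; have /(uniform_csnP X_gen)/(_ q e cq e0) := cv t0 f t00.
  by apply: filterS => s hs l lt0; apply: hs; rewrite /= in_itv.
apply/(uniform_csnP X_gen) => q e cq e0; apply/near_right0P.
have e20 : 0 < e / 2 by rewrite divr_gt0.
have [d d0 hd] := core_cvg X_gen X_hausdorff X_complete sgT expZ_generator eqT
  coreD f cq e20 t00.
exists d => // s sd l; rewrite /= in_itv => /= lt0.
apply: le_lt_trans (hd s sd l lt0) _.
exact: half_lt.
Qed.
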